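(* Let $\zeta_5=e^{2\pi i/5}$, and for $\tau\in\mathbb{H}^2$ put $A=\theta[1;\tfrac15]$, $B=\theta[1;\tfrac35]$ and $d_k=\theta[\tfrac35;\tfrac k5]$ for $k\in\{1,3,5,7,9\}$ (theta constants at $\zeta=0$). Then for every $\tau\in\mathbb{H}^2$: $$\frac AB=\frac{d_1^2d_3-\zeta_5^2d_9^2d_7}{\zeta_5d_7^2d_1-\zeta_5d_3^2d_9},\qquad \frac AB=\frac{\zeta_5d_5^2d_7+d_3^2d_1}{d_1^2d_5+\zeta_5d_7^2d_3},$$ $$\frac AB=\frac{\zeta_5d_7^2d_5-\zeta_5d_9^2d_1}{d_1^2d_7+\zeta_5d_5^2d_9},\qquad \frac AB=\frac{-d_1^2d_9+d_3^2d_5}{\zeta_5d_9^2d_3+d_5^2d_1},$$ $$\frac AB=\frac{\zeta_5d_7^2d_9+d_5^2d_3}{d_3^2d_7+\zeta_5d_9^2d_5}.$$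
   Context: Let $\mathbb{H}^2=\{\tau\in\mathbb{C}:\Im\tau>0\}$. For $(\epsilon,\epsilon')\in\mathbb{R}^2$, $$\theta[\epsilon;\epsilon'](\zeta,\tau)=\sum_{n\in\mathbb{Z}}\exp\Big(2\pi i\Big[\tfrac12\big(n+\tfrac{\epsilon}{2}\big)^2\tau+\big(n+\tfrac{\epsilon}{2}\big)\big(\zeta+\tfrac{\epsilon'}{2}\big)\Big]\Big),$$ and $\theta[\epsilon;\epsilon']=\theta[\epsilon;\epsilon'](0,\tau)$ denotes the theta constant, a function of $\tau$. *)

(* Defs.v *)
From Stdlib Require Import Reals.
From Coquelicot Require Import Coquelicot.
Open Scope R_scope.

Definition Cexp (z : C) : C :=
  (exp (Re z) * cos (Im z), exp (Re z) * sin (Im z)).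

Definition CSeries (a : nat -> C) : C :=
  (Series (fun n => Re (a n)), Series (fun n => Im (a n))).

Definition theta_term (e e' : R) (zeta tau : C) (n : Z) : C :=
  let m : C := RtoC (IZR n + e / 2) in
  Cexp (2 * PI * Ci * ((1/2) * m * m * tau + m * (zeta + RtoC (e' / 2))))%C.

(* theta[e;e'](zeta,tau) = sum over n in Z, summed as
   sum_{n>=0} (term n + term (-n-1)) (the series converges absolutely on H) *)
Definition theta (e e' : R) (zeta tau : C) : C :=
  CSeries (fun k => theta_term e e' zeta tau (Z.of_nat k)
                    + theta_term e e' zeta tau (- Z.of_nat k - 1))%C.

Definition thetac (e e' : R) (tau : C) : C := theta e e' 0 tau.

Definition zeta5 : C := Cexp (2 * PI * Ci / 5)%C.

(* Main.v *)
(* Up to exponential factors, every theta constant in the statement is a value of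
   the odd theta function f: d_k = f(u + j/5) with u = -tau/5 and k = 5 + 2j,
   A = f(2/5) and B = f(1/5).  The three-term identity
     f(2u) f(2s) f(s)^2 = f(u) (f(u+2s) f(u-s)^2 - f(u-2s) f(u+s)^2),
   taken with s = 1/5 and with s = 2/5 and compared by means of
   f(4/5) = f(1/5), gives A : B as a quotient of two cubic forms; the five
   formulas are its instances at the points u + j/5.  The identity itself is a
   Pluecker relation: multiplying two theta series expresses f(x+y) f(x-y) as a
   2x2 determinant in theta constants at 2 tau.
   The quotient makes sense because f vanishes neither at u + j/5 nor at its
   double: by Landen's transformation a zero for tau would produce one for
   2^n tau, where a single term of the series dominates for large n. *)
Require Import Defs.
From Stdlib Require Import Reals.
From Stdlib Require Import Lra Lia List Permutation ZArith.
From Coquelicot Require Import Coquelicot.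
Import ListNotations.
Open Scope C_scope.

(** * Finite sums over lists *)

Fixpoint lsum {I : Type} (f : I -> C) (l : list I) : C :=
  match l with
  | [] => 0
  | x :: l => f x + lsum f l
  end.

Fixpoint lsumR {I : Type} (f : I -> R) (l : list I) : R :=
  match l with
  | [] => 0%R
  | x :: l => (f x + lsumR f l)%R
  end.

Lemma lsum_app {I : Type} (f : I -> C) (l l' : list I) :
  lsum f (l ++ l') = lsum f l + lsum f l'.
Proof. induction l as [|x l IH]; simpl; [ring | rewrite IH; ring]. Qed.

Lemma lsumR_app {I : Type} (f : I -> R) (l l' : list I) :
  lsumR f (l ++ l') = (lsumR f l + lsumR f l')%R.
Proof. induction l as [|x l IH]; simpl; [ring | rewrite IH; ring]. Qed.

Lemma lsum_map {I J : Type} (g : I -> J) (f : J -> C) (l : list I) :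
  lsum f (map g l) = lsum (fun i => f (g i)) l.
Proof. induction l as [|x l IH]; simpl; [|rewrite IH]; reflexivity. Qed.

Lemma lsumR_map {I J : Type} (g : I -> J) (f : J -> R) (l : list I) :
  lsumR f (map g l) = lsumR (fun i => f (g i)) l.
Proof. induction l as [|x l IH]; simpl; [|rewrite IH]; reflexivity. Qed.

Lemma lsum_ext {I : Type} (f g : I -> C) (l : list I) :
  (forall i, f i = g i) -> lsum f l = lsum g l.
Proof. intros E; induction l as [|x l IH]; simpl; [|rewrite IH, E]; reflexivity. Qed.

Lemma lsum_scal {I : Type} (c : C) (f : I -> C) (l : list I) :
  lsum (fun i => c * f i) l = c * lsum f l.
Proof. induction l as [|x l IH]; simpl; [|rewrite IH]; ring. Qed.

Lemma lsumR_scal {I : Type} (c : R) (f : I -> R) (l : list I) :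
  lsumR (fun i => c * f i)%R l = (c * lsumR f l)%R.
Proof. induction l as [|x l IH]; simpl; [|rewrite IH]; ring. Qed.

Lemma lsum_list_prod {I J : Type} (f : I -> C) (g : J -> C) l l' :
  lsum (fun p => f (fst p) * g (snd p)) (list_prod l l') = lsum f l * lsum g l'.
Proof.
induction l as [|x l IH]; simpl; [ring|].
rewrite lsum_app, IH, lsum_map; simpl; rewrite lsum_scal; ring.
Qed.

Lemma lsumR_list_prod {I J : Type} (f : I -> R) (g : J -> R) l l' :
  lsumR (fun p => f (fst p) * g (snd p))%R (list_prod l l')
  = (lsumR f l * lsumR g l')%R.
Proof.
induction l as [|x l IH]; simpl; [ring|].
rewrite lsumR_app, IH, lsumR_map; simpl; rewrite lsumR_scal; ring.
Qed.

Lemma lsum_perm {I : Type} (f : I -> C) (l l' : list I) :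
  Permutation l l' -> lsum f l = lsum f l'.
Proof.
induction 1; simpl; [reflexivity | rewrite IHPermutation; reflexivity | ring |].
congruence.
Qed.

Lemma lsumR_perm {I : Type} (f : I -> R) (l l' : list I) :
  Permutation l l' -> lsumR f l = lsumR f l'.
Proof.
induction 1; simpl; [reflexivity | rewrite IHPermutation; reflexivity | ring |].
congruence.
Qed.

Lemma Cmod_lsum_le {I : Type} (f : I -> C) (g : I -> R) (l : list I) :
  (forall i, Cmod (f i) <= g i)%R -> (Cmod (lsum f l) <= lsumR g l)%R.
Proof.
intros H; induction l as [|x l IH]; simpl; [rewrite Cmod_0; lra|].
eapply Rle_trans; [apply Cmod_triangle|]; specialize (H x); lra.
Qed.

Lemma lsumR_ge0 {I : Type} (g : I -> R) (l : list I) :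
  (forall i, 0 <= g i)%R -> (0 <= lsumR g l)%R.
Proof.
intros H; induction l as [|x l IH]; simpl; [lra|]; specialize (H x); lra.
Qed.

Lemma incl_Permutation_app {I : Type} (l l' : list I) :
  NoDup l -> incl l l' -> exists r, Permutation l' (l ++ r).
Proof.
revert l'; induction l as [|x l IH]; intros l' Hl Hi; [exists l'; reflexivity|].
apply NoDup_cons_iff in Hl; destruct Hl as [Hx Hl].
destruct (in_split x l' (Hi x (or_introl eq_refl))) as [l1 [l2 E]].
destruct (IH (l1 ++ l2)%list Hl) as [r Hr].
{ intros y Hy; assert (Hy' := Hi y (or_intror Hy)).
  rewrite E in Hy'; apply in_app_or in Hy'; apply in_or_app.
  destruct Hy' as [Hy'|[Hy'|Hy']]; auto; subst; contradiction. }
exists r; rewrite E, <- Permutation_middle, Hr; reflexivity.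
Qed.

(** Only the terms of [l1] outside [l0] survive in the difference, and their majorants are among
    those that [l2] adds to [l0]. This stands in for a theory of rearrangement of absolutely
    convergent double series. *)
Lemma lsum_sandwich {I : Type} (f : I -> C) (g : I -> R) (l0 l1 l2 : list I) :
  (forall i, Cmod (f i) <= g i)%R -> NoDup l0 -> NoDup l1 ->
  incl l0 l1 -> incl l1 l2 ->
  (Cmod (lsum f l1 - lsum f l0) <= lsumR g l2 - lsumR g l0)%R.
Proof.
intros Hfg N0 N1 I01 I12.
assert (Hg : forall i, (0 <= g i)%R).
{ intros i; eapply Rle_trans; [apply Cmod_ge_0 | apply Hfg]. }
destruct (incl_Permutation_app l0 l1 N0 I01) as [r Hr].
destruct (incl_Permutation_app l1 l2 N1 I12) as [r' Hr'].
rewrite (lsum_perm f _ _ Hr), lsum_app.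
replace (lsum f l0 + lsum f r - lsum f l0) with (lsum f r) by ring.
rewrite (lsumR_perm g _ _ Hr'), lsumR_app, (lsumR_perm g _ _ Hr), lsumR_app.
assert (H := Cmod_lsum_le f g r Hfg); assert (H' := lsumR_ge0 g r' Hg); lra.
Qed.

(** * Integer ranges, squares and rotated squares *)

(* The integers [-N <= n < N], in the summation order of [theta]. *)
Fixpoint zrange (N : nat) : list Z :=
  match N with
  | O => []
  | S N => Z.of_nat N :: (- Z.of_nat N - 1)%Z :: zrange N
  end.

Lemma in_zrange (N : nat) (n : Z) :
  In n (zrange N) <-> (- Z.of_nat N <= n < Z.of_nat N)%Z.
Proof.
induction N as [|N IH]; [simpl; lia|].
change (zrange (S N)) with (Z.of_nat N :: (- Z.of_nat N - 1)%Z :: zrange N).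
cbn [In]; rewrite IH; lia.
Qed.

Lemma NoDup_zrange (N : nat) : NoDup (zrange N).
Proof.
induction N as [|N IH]; [constructor|].
change (zrange (S N)) with (Z.of_nat N :: (- Z.of_nat N - 1)%Z :: zrange N).
constructor; [cbn [In]; rewrite in_zrange; lia|].
constructor; [rewrite in_zrange; lia | exact IH].
Qed.

Definition box (N : nat) : list (Z * Z) := list_prod (zrange N) (zrange N).

Lemma in_box (N : nat) (m n : Z) :
  In (m, n) (box N) <->
  (- Z.of_nat N <= m < Z.of_nat N)%Z /\ (- Z.of_nat N <= n < Z.of_nat N)%Z.
Proof. unfold box; rewrite in_prod_iff, !in_zrange; reflexivity. Qed.

Lemma NoDup_list_prod {I J : Type} (l : list I) (l' : list J) :
  NoDup l -> NoDup l' -> NoDup (list_prod l l').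
Proof.
intros Hl Hl'; induction Hl as [|x l Hx Hl IH]; simpl; [constructor|].
apply NoDup_app; [apply FinFun.Injective_map_NoDup; [congruence | exact Hl'] | exact IH |].
intros [a b] H1 H2; apply in_map_iff in H1; destruct H1 as [y [E _]].
injection E as <- <-; apply in_prod_iff in H2; tauto.
Qed.

Lemma NoDup_box (N : nat) : NoDup (box N).
Proof. apply NoDup_list_prod; apply NoDup_zrange. Qed.

(* The sublattice [m + n] even and its coset, in the coordinates
   [(m + n) / 2, (m - n) / 2], rounded up and down respectively. *)
Definition even_pair (p : Z * Z) : Z * Z := (fst p + snd p, fst p - snd p)%Z.
Definition odd_pair (p : Z * Z) : Z * Z := (fst p + snd p, fst p - snd p - 1)%Z.

Definition rotated_box (N : nat) : list (Z * Z) :=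
  map even_pair (box N) ++ map odd_pair (box N).

Lemma NoDup_rotated_box (N : nat) : NoDup (rotated_box N).
Proof.
apply NoDup_app.
- apply FinFun.Injective_map_NoDup; [|apply NoDup_box].
  intros [p k] [p' k'] E; injection E as E1 E2; f_equal; simpl in *; lia.
- apply FinFun.Injective_map_NoDup; [|apply NoDup_box].
  intros [p k] [p' k'] E; injection E as E1 E2; f_equal; simpl in *; lia.
(* The parity of [m + n] separates the two images. *)
- intros [m n] H1 H2; apply in_map_iff in H1, H2.
  destruct H1 as [[p k] [E1 _]], H2 as [[p' k'] [E2 _]].
  injection E1 as E1 E1'; injection E2 as E2 E2'; simpl in *; lia.
Qed.

Lemma box_incl_rotated_box (N : nat) : incl (box N) (rotated_box N).
Proof.
intros [m n] H; apply in_box in H; apply in_or_app.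
destruct (Z.Even_or_Odd (m + n)) as [[p Hp]|[p Hp]]; [left | right].
- apply in_map_iff; exists (p, m - p)%Z; split.
  + unfold even_pair; simpl; f_equal; lia.
  + apply in_box; lia.
- apply in_map_iff; exists (p + 1, m - p - 1)%Z; split.
  + unfold odd_pair; simpl; f_equal; lia.
  + apply in_box; lia.
Qed.

Lemma rotated_box_incl_box (N : nat) : incl (rotated_box N) (box (2 * N)).
Proof.
intros [m n] H; apply in_app_or in H; apply in_box.
(* The lowest value is [p - k - 1 = -2N], at [p = -N] and [k = N - 1]; the half-open range of side
   [2 * N] just contains it. *)
destruct H as [H|H]; apply in_map_iff in H; destruct H as [[p k] [E H]];
  apply in_box in H; injection E as <- <-; simpl; lia.
Qed.

(** * Limits of complex sequences *)

(** Taken componentwise to match [CSeries], which sums real and imaginary parts separately. *)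
Definition Ccv (u : nat -> C) (l : C) : Prop :=
  is_lim_seq (fun n => Re (u n)) (Re l) /\ is_lim_seq (fun n => Im (u n)) (Im l).

Lemma Ccv_unique u l l' : Ccv u l -> Ccv u l' -> l = l'.
Proof.
intros [H1 H2] [H1' H2']; destruct l as [x y], l' as [x' y']; f_equal.
- apply is_lim_seq_unique in H1, H1'; rewrite H1 in H1'; injection H1'; auto.
- apply is_lim_seq_unique in H2, H2'; rewrite H2 in H2'; injection H2'; auto.
Qed.

Lemma Ccv_ext u v l : (forall n, u n = v n) -> Ccv u l -> Ccv v l.
Proof.
intros E [H1 H2]; split; eapply is_lim_seq_ext; eauto;
  intros n; simpl; rewrite E; reflexivity.
Qed.

Lemma Ccv_plus u v l l' : Ccv u l -> Ccv v l' -> Ccv (fun n => u n + v n) (l + l').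
Proof.
intros [H1 H2] [H1' H2']; split; simpl.
- exact (is_lim_seq_plus' _ _ _ _ H1 H1').
- exact (is_lim_seq_plus' _ _ _ _ H2 H2').
Qed.

Lemma Ccv_mult u v l l' : Ccv u l -> Ccv v l' -> Ccv (fun n => u n * v n) (l * l').
Proof.
intros [H1 H2] [H1' H2']; split; simpl.
- exact (is_lim_seq_minus' _ _ _ _ (is_lim_seq_mult' _ _ _ _ H1 H1')
    (is_lim_seq_mult' _ _ _ _ H2 H2')).
- exact (is_lim_seq_plus' _ _ _ _ (is_lim_seq_mult' _ _ _ _ H1 H2')
    (is_lim_seq_mult' _ _ _ _ H2 H1')).
Qed.

Lemma Ccv_const c : Ccv (fun _ => c) c.
Proof. split; apply is_lim_seq_const. Qed.

Lemma Im_le_Cmod (z : C) : (Rabs (Im z) <= Cmod z)%R.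
Proof.
exact (Rle_trans _ _ _ (Rmax_r _ _) (Rmax_Cmod z)).
Qed.

Lemma Ccv_0_le u v :
  (forall n, Cmod (u n) <= v n)%R -> is_lim_seq v 0%R -> Ccv u 0.
Proof.
intros H Hv.
assert (Hv' : is_lim_seq (fun n => - v n)%R 0%R).
{ replace (Finite 0) with (Rbar_opp 0) by (simpl; now rewrite Ropp_0).
  exact (proj1 (is_lim_seq_opp v (Finite 0)) Hv). }
split; apply (is_lim_seq_le_le (fun n => - v n)%R _ v); auto; intros n.
- apply Rabs_le_between, (Rle_trans _ (Cmod (u n))); [apply re_le_Cmod | apply H].
- apply Rabs_le_between, (Rle_trans _ (Cmod (u n))); [apply Im_le_Cmod | apply H].
Qed.

Lemma is_lim_seq_double_minus (v : nat -> R) (l : R) :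
  is_lim_seq v l -> is_lim_seq (fun N => v (2 * N)%nat - v N)%R 0%R.
Proof.
intros H; replace 0%R with (l - l)%R by ring.
apply is_lim_seq_minus'; [|exact H].
apply (is_lim_seq_subseq v l (fun N => 2 * N)%nat); [|exact H].
apply eventually_subseq; intros n; lia.
Qed.

(** * The complex exponential and points of the unit circle *)

Lemma Cmod_Cexp (x y : R) : Cmod (Cexp (x, y)) = exp x.
Proof.
unfold Cexp, Cmod; cbn [Re Im fst snd].
replace ((exp x * cos y) ^ 2 + (exp x * sin y) ^ 2)%R with (exp x ^ 2)%R.
- apply sqrt_pow2, Rlt_le, exp_pos.
- assert (H := sin2_cos2 y); unfold Rsqr in H.
  transitivity (exp x ^ 2 * (sin y * sin y + cos y * cos y))%R; [rewrite H|]; ring.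
Qed.

Lemma Cexp_add (x y x' y' : R) :
  Cexp (x + x', y + y')%R = Cexp (x, y) * Cexp (x', y').
Proof.
unfold Cexp; cbn [Re Im fst snd]; rewrite exp_plus, cos_plus, sin_plus.
unfold Cmult; cbn [fst snd]; f_equal; ring.
Qed.

(** Angles are counted in full turns, so that roots of unity have rational arguments. *)
Definition cis (t : R) : C := Cexp (0, 2 * PI * t)%R.

Lemma cis_add (s t : R) : cis (s + t) = cis s * cis t.
Proof. unfold cis; rewrite <- Cexp_add; do 2 f_equal; ring. Qed.

Lemma cis_0 : cis 0 = 1.
Proof.
unfold cis, Cexp; cbn [Re Im fst snd]; rewrite Rmult_0_r, exp_0, cos_0, sin_0.
unfold RtoC; f_equal; ring.
Qed.

Lemma cis_half : cis (1 / 2) = - (1).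
Proof.
unfold cis, Cexp; cbn [Re Im fst snd].
replace (2 * PI * (1 / 2))%R with PI by field.
rewrite exp_0, cos_PI, sin_PI; unfold Copp, RtoC; simpl; f_equal; ring.
Qed.

Lemma cis_neq_0 (t : R) : cis t <> 0.
Proof.
intros E; apply (f_equal Cmod) in E; unfold cis in E.
rewrite Cmod_Cexp, Cmod_0, exp_0 in E; lra.
Qed.

Lemma cis_INR (k : nat) : cis (INR k) = 1.
Proof.
induction k as [|k IH]; [apply cis_0|].
rewrite S_INR; replace (INR k + 1)%R with (INR k + 1 / 2 + 1 / 2)%R by field.
rewrite !cis_add, IH, cis_half; ring.
Qed.

Lemma cis_IZR (n : Z) : cis (IZR n) = 1.
Proof.
destruct (Z_le_gt_dec 0 n) as [H|H].
- rewrite <- (Z2Nat.id n H), <- INR_IZR_INZ; apply cis_INR.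
- transitivity (cis (IZR n) * cis (INR (Z.to_nat (- n)))).
  + rewrite cis_INR; ring.
  + rewrite <- cis_add, INR_IZR_INZ, Z2Nat.id, <- plus_IZR by lia.
    replace (n + - n)%Z with 0%Z by lia; apply cis_0.
Qed.

(** * Bounds on limits, and series over the integers with geometric majorants *)

Lemma Ccv_neq_0 (u : nat -> C) (l : C) (c : R) :
  (0 < c)%R -> (forall n, c <= Cmod (u n))%R -> Ccv u l -> l <> 0.
Proof.
intros Hc H [H1 H2] ->.
(* The squared moduli are at least [c * c], but would tend to 0. *)
assert (L := is_lim_seq_plus' _ _ _ _ (is_lim_seq_mult' _ _ _ _ H1 H1)
  (is_lim_seq_mult' _ _ _ _ H2 H2)).
assert (Hle : Rbar_le (c * c)%R (Re 0 * Re 0 + Im 0 * Im 0)%R).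
{ refine (is_lim_seq_le _ _ _ _ _ (is_lim_seq_const _) L); intros n.
  assert (E := Cmod2_alt (u n)); specialize (H n).
  apply Rle_trans with (Cmod (u n) ^ 2)%R; [nra | rewrite E; lra]. }
simpl in Hle; nra.
Qed.

Lemma is_lim_seq_lsum_zrange (f : Z -> R) (C x : R) :
  (0 <= x < 1)%R -> (forall n, Rabs (f n) <= C * x ^ Z.abs_nat n)%R ->
  is_lim_seq (fun N => lsumR f (zrange N))
    (Series (fun k => f (Z.of_nat k) + f (- Z.of_nat k - 1)%Z)%R).
Proof.
intros Hx Hf.
assert (HC : (0 <= C)%R).
{ assert (H := Hf 0%Z); assert (H' := Rabs_pos (f 0%Z)); simpl in H; lra. }
set (u := fun k => (f (Z.of_nat k) + f (- Z.of_nat k - 1)%Z)%R).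
assert (Hu : ex_series u).
{ apply (@ex_series_le R_AbsRing R_CompleteNormedModule u
           (fun k => 2 * C * x ^ k)%R).
  - intros k; unfold norm; simpl; unfold abs; simpl; unfold u.
    eapply Rle_trans; [apply Rabs_triang|].
    assert (H1 := Hf (Z.of_nat k)); assert (H2 := Hf (- Z.of_nat k - 1)%Z).
    replace (Z.abs_nat (Z.of_nat k)) with k in H1 by lia.
    replace (Z.abs_nat (- Z.of_nat k - 1)) with (S k) in H2 by lia.
    assert (0 <= x ^ k)%R by (apply pow_le; lra).
    assert (x ^ S k <= x ^ k)%R by (simpl; nra).
    nra.
  - apply (@ex_series_scal R_AbsRing R_NormedModule (2 * C)%R (pow x)), ex_series_geom; rewrite Rabs_right; lra. }
(* The partial sum of [u] up to index [N] inclusive is the sum over [zrange (S N)], hence the shift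
   by one. *)
apply is_lim_seq_incr_1; apply Series_correct in Hu.
apply is_lim_seq_ext with (2 := Hu); intros N.
induction N as [|N IH].
- rewrite sum_O; unfold u; simpl; ring.
- rewrite sum_Sn, IH.
  change (lsumR f (zrange (S N)) + u (S N) = f (Z.of_nat (S N))
    + (f (- Z.of_nat (S N) - 1)%Z + lsumR f (zrange (S N))))%R; unfold u; ring.
Qed.

Lemma Re_lsum {I : Type} (f : I -> C) l : Re (lsum f l) = lsumR (fun i => Re (f i)) l.
Proof. induction l as [|i l IH]; simpl; [|rewrite <- IH]; reflexivity. Qed.

Lemma Im_lsum {I : Type} (f : I -> C) l : Im (lsum f l) = lsumR (fun i => Im (f i)) l.
Proof. induction l as [|i l IH]; simpl; [|rewrite <- IH]; reflexivity. Qed.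

Lemma Ccv_lsum_zrange (f : Z -> C) (K x : R) :
  (0 <= x < 1)%R -> (forall n, Cmod (f n) <= K * x ^ Z.abs_nat n)%R ->
  Ccv (fun N => lsum f (zrange N))
    (CSeries (fun k => f (Z.of_nat k) + f (- Z.of_nat k - 1)%Z)).
Proof.
intros Hx Hf; split.
- apply (is_lim_seq_ext (fun N => lsumR (fun n => Re (f n)) (zrange N))).
  + intros N; now rewrite Re_lsum.
  + apply (is_lim_seq_lsum_zrange (fun n => Re (f n)) K x Hx); intros n.
    eapply Rle_trans; [apply re_le_Cmod | apply Hf].
- apply (is_lim_seq_ext (fun N => lsumR (fun n => Im (f n)) (zrange N))).
  + intros N; now rewrite Im_lsum.
  + apply (is_lim_seq_lsum_zrange (fun n => Im (f n)) K x Hx); intros n.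
    eapply Rle_trans; [apply Im_le_Cmod | apply Hf].
Qed.

(** Apart from 0, [zrange (S N)] consists of [1..N] and [-1..-(N+1)]. The two geometric sums have
    numerators [x - x ^ S N] and [x - x ^ S (S N)] over the denominator [1 - x], which is multiplied
    out. *)
Lemma lsum_zrange_dominant (f : Z -> C) (K x : R) (N : nat) :
  (0 <= x < 1)%R -> (forall n, Cmod (f n) <= K * x ^ Z.abs_nat n)%R ->
  ((1 - x) * Cmod (lsum f (zrange (S N)) - f 0%Z)
   <= K * (2 * x - x ^ S N - x ^ S (S N)))%R.
Proof.
intros Hx Hf; induction N as [|N IH].
- assert (H := Hf (-1)%Z); simpl in H |- *.
  replace (f 0%Z + (f (-1)%Z + 0) - f 0%Z) with (f (-1)%Z) by ring.
  apply Rle_trans with ((1 - x) * (K * (x * 1)))%R;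
    [apply Rmult_le_compat_l|]; lra.
- set (S1 := lsum f (zrange (S N))) in *.
  change (lsum f (zrange (S (S N))))
    with (f (Z.of_nat (S N)) + (f (- Z.of_nat (S N) - 1)%Z + S1)).
  assert (H1 := Hf (Z.of_nat (S N))); assert (H2 := Hf (- Z.of_nat (S N) - 1)%Z).
  replace (Z.abs_nat (Z.of_nat (S N))) with (S N) in H1 by lia.
  replace (Z.abs_nat (- Z.of_nat (S N) - 1)) with (S (S N)) in H2 by lia.
  set (p := f (Z.of_nat (S N))) in *; set (q := f (- Z.of_nat (S N) - 1)%Z) in *.
  replace (p + (q + S1) - f 0%Z) with (p + (q + (S1 - f 0%Z))) by ring.
  assert (T1 := Cmod_triangle p (q + (S1 - f 0%Z))).
  assert (T2 := Cmod_triangle q (S1 - f 0%Z)).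
  set (X := (x ^ S N)%R) in *.
  change (x ^ S (S N))%R with (x * X)%R in *.
  change (x ^ S (S (S N)))%R with (x * (x * X))%R.
  apply Rle_trans with ((1 - x) * (K * X + K * (x * X) + Cmod (S1 - f 0%Z)))%R.
  + apply Rmult_le_compat_l; lra.
  + nra.
Qed.

(** * Theta series with real characteristics *)

(** This is exp(pi i (n+a)^2 tau + 2 pi i (n+a) b), with the exponent split into real and imaginary
    parts so that products of terms reduce to real identities between exponents. *)
Definition gterm (a b : R) (tau : C) (n : Z) : C :=
  Cexp (- (PI * Im tau * (IZR n + a) ^ 2),
        PI * Re tau * (IZR n + a) ^ 2 + 2 * PI * (IZR n + a) * b)%R.

Definition Th (a b : R) (tau : C) : C :=
  CSeries (fun k => gterm a b tau (Z.of_nat k) + gterm a b tau (- Z.of_nat k - 1)).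

Lemma CSeries_ext (u v : nat -> C) : (forall k, u k = v k) -> CSeries u = CSeries v.
Proof.
intros E; unfold CSeries; f_equal; apply Series_ext; intros k; now rewrite E.
Qed.

Lemma thetac_Th (e e' : R) (tau : C) : thetac e e' tau = Th (e / 2) (e' / 2) tau.
Proof.
apply CSeries_ext; intros k.
assert (E : forall n, theta_term e e' 0 tau n = gterm (e / 2) (e' / 2) tau n).
{ intros n; unfold theta_term, gterm; f_equal; destruct tau as [x y].
  rewrite <- RtoC_div by lra; unfold Cmult, Cplus, Ci, RtoC; cbn [Re Im fst snd]; f_equal; field. }
now rewrite !E.
Qed.

Lemma Cmod_gterm a b tau n :
  Cmod (gterm a b tau n) = exp (- (PI * Im tau * (IZR n + a) ^ 2)).
Proof. apply Cmod_Cexp. Qed.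

Lemma exp_pow_nat (t : R) (k : nat) : (exp t ^ k = exp (INR k * t))%R.
Proof.
induction k as [|k IH]; [simpl; rewrite Rmult_0_l, exp_0; reflexivity|].
rewrite S_INR; simpl; rewrite IH, <- exp_plus; f_equal; ring.
Qed.

Lemma INR_abs_nat (n : Z) : INR (Z.abs_nat n) = Rabs (IZR n).
Proof. rewrite INR_IZR_INZ, Zabs2Nat.id_abs; apply abs_IZR. Qed.

Lemma IZR_sqr_ge_abs (n : Z) : (Rabs (IZR n) <= IZR n ^ 2)%R.
Proof.
rewrite <- abs_IZR; simpl; rewrite Rmult_1_r, <- mult_IZR; apply IZR_le; nia.
Qed.

Lemma exp_le_exp (s t : R) : (s <= t)%R -> (exp s <= exp t)%R.
Proof. intros [H | ->]; [now apply Rlt_le, exp_increasing | apply Rle_refl]. Qed.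

(** From (n + 2a)^2 >= 0 follows (n+a)^2 >= n^2/2 - a^2, and n^2 >= |n| for integers. The ratio is
    below 1 for every [a], which gives convergence. *)
Lemma gterm_le (a b : R) (tau : C) (n : Z) : (0 < Im tau)%R ->
  (Cmod (gterm a b tau n)
   <= exp (PI * Im tau * a ^ 2) * exp (- (PI * Im tau / 2)) ^ Z.abs_nat n)%R.
Proof.
intros Ht; rewrite Cmod_gterm, exp_pow_nat, INR_abs_nat, <- exp_plus.
assert (H := IZR_sqr_ge_abs n); assert (HP := PI_RGT_0).
assert (0 <= (IZR n + 2 * a) ^ 2)%R by apply pow2_ge_0.
assert (0 < PI * Im tau)%R by nra.
apply exp_le_exp; set (m := Rabs (IZR n)) in *; nra.
Qed.

(** Here (n+a)^2 - a^2 = n^2 + 2na >= |n| (1 - 2|a|). The constant is now the modulus of the central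
    term itself, as needed to show that this term dominates. *)
Lemma gterm_le_dominant (a b : R) (tau : C) (n : Z) : (0 < Im tau)%R ->
  (Cmod (gterm a b tau n)
   <= Cmod (gterm a b tau 0)
      * exp (- (PI * Im tau * (1 - 2 * Rabs a))) ^ Z.abs_nat n)%R.
Proof.
intros Ht; rewrite !Cmod_gterm, exp_pow_nat, INR_abs_nat, <- exp_plus.
assert (H := IZR_sqr_ge_abs n); assert (HP := PI_RGT_0).
assert (Hn : (- (IZR n * a) <= Rabs (IZR n) * Rabs a)%R).
{ rewrite <- Rabs_mult, <- Rabs_Ropp; apply RRle_abs. }
assert (0 < PI * Im tau)%R by nra.
apply exp_le_exp; set (m := Rabs (IZR n)) in *; set (A := Rabs a) in *.
nra.
Qed.

Lemma exp_neg_lt_1 (t : R) : (0 < t)%R -> (0 <= exp (- t) < 1)%R.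
Proof.
intros H; split; [apply Rlt_le, exp_pos | rewrite <- exp_0; apply exp_increasing; lra].
Qed.

Lemma Ccv_Th (a b : R) (tau : C) : (0 < Im tau)%R ->
  Ccv (fun N => lsum (gterm a b tau) (zrange N)) (Th a b tau).
Proof.
intros Ht; eapply Ccv_lsum_zrange; [|intros n; now apply gterm_le].
apply exp_neg_lt_1; assert (HP := PI_RGT_0); nra.
Qed.

Lemma ex_lim_lsum_Cmod_gterm (a b : R) (tau : C) : (0 < Im tau)%R ->
  exists l : R, is_lim_seq (fun N => lsumR (fun n => Cmod (gterm a b tau n)) (zrange N)) l.
Proof.
intros Ht; eexists; eapply is_lim_seq_lsum_zrange.
- apply (exp_neg_lt_1 (PI * Im tau / 2)); assert (HP := PI_RGT_0); nra.
- intros n; rewrite Rabs_pos_eq by apply Cmod_ge_0; now apply gterm_le.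
Qed.

(** * The product of two theta series *)

Lemma Im_double (tau : C) : Im (2 * tau) = (2 * Im tau)%R.
Proof. unfold Im; simpl; ring. Qed.

Lemma Re_double (tau : C) : Re (2 * tau) = (2 * Re tau)%R.
Proof. unfold Re; simpl; ring. Qed.

Lemma gterm_even_pair a b a' b' tau (p : Z * Z) :
  gterm a b tau (fst (even_pair p)) * gterm a' b' tau (snd (even_pair p))
  = gterm ((a + a') / 2) (b + b') (2 * tau) (fst p)
    * gterm ((a - a') / 2) (b - b') (2 * tau) (snd p).
Proof.
destruct p as [p k]; unfold gterm, even_pair; cbn [fst snd].
rewrite <- !Cexp_add, Im_double, Re_double, plus_IZR, minus_IZR.
f_equal; f_equal; field.
Qed.

Lemma gterm_odd_pair a b a' b' tau (p : Z * Z) :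
  gterm a b tau (fst (odd_pair p)) * gterm a' b' tau (snd (odd_pair p))
  = gterm ((a + a' - 1) / 2) (b + b') (2 * tau) (fst p)
    * gterm ((a - a' + 1) / 2) (b - b') (2 * tau) (snd p).
Proof.
destruct p as [p k]; unfold gterm, odd_pair; cbn [fst snd].
rewrite <- !Cexp_add, Im_double, Re_double, plus_IZR, !minus_IZR.
f_equal; f_equal; field.
Qed.

(* Substitute [m + n = 2 p - r], [m - n = 2 k + r] with [r = 0, 1] in the double
   series; the rotated square of side [2 N] lies between two straight ones. *)
Lemma Th_mult (a b a' b' : R) (tau : C) : (0 < Im tau)%R ->
  Th a b tau * Th a' b' tau
  = Th ((a + a') / 2) (b + b') (2 * tau) * Th ((a - a') / 2) (b - b') (2 * tau)
  + Th ((a + a' - 1) / 2) (b + b') (2 * tau)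
    * Th ((a - a' + 1) / 2) (b - b') (2 * tau).
Proof.
intros Ht; assert (Ht2 : (0 < Im (2 * tau))%R) by (rewrite Im_double; lra).
set (h := fun p : Z * Z => gterm a b tau (fst p) * gterm a' b' tau (snd p)).
set (g := fun p : Z * Z =>
  (Cmod (gterm a b tau (fst p)) * Cmod (gterm a' b' tau (snd p)))%R).
assert (L1 : Ccv (fun N => lsum h (box N)) (Th a b tau * Th a' b' tau)).
{ eapply Ccv_ext; [|exact (Ccv_mult _ _ _ _ (Ccv_Th a b tau Ht) (Ccv_Th a' b' tau Ht))].
  intros N; symmetry; apply lsum_list_prod. }
(* The difference is bounded by what the double series of moduli gains between sides [N] and
   [2 * N], and that series converges. *)
assert (L0 : Ccv (fun N => lsum h (rotated_box N) - lsum h (box N)) 0).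
{ destruct (ex_lim_lsum_Cmod_gterm a b tau Ht) as [l Hl].
  destruct (ex_lim_lsum_Cmod_gterm a' b' tau Ht) as [l' Hl'].
  apply (Ccv_0_le _ (fun N => lsumR g (box (2 * N)) - lsumR g (box N))%R).
  - intros N; apply lsum_sandwich.
    + intros p; unfold h, g; rewrite Cmod_mult; apply Rle_refl.
    + apply NoDup_box.
    + apply NoDup_rotated_box.
    + apply box_incl_rotated_box.
    + apply rotated_box_incl_box.
  - apply (is_lim_seq_double_minus (fun N => lsumR g (box N)) (l * l')).
    eapply is_lim_seq_ext; [|exact (is_lim_seq_mult' _ _ _ _ Hl Hl')].
    intros N; symmetry.
    exact (lsumR_list_prod (fun n => Cmod (gterm a b tau n))
      (fun n => Cmod (gterm a' b' tau n)) _ _). }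
apply (Ccv_unique (fun N => lsum h (rotated_box N))).
- replace (Th a b tau * Th a' b' tau) with (Th a b tau * Th a' b' tau + 0) by ring.
  eapply Ccv_ext; [|exact (Ccv_plus _ _ _ _ L1 L0)]; intros N; simpl; ring.
- eapply Ccv_ext; [|apply Ccv_plus; apply Ccv_mult; apply Ccv_Th; exact Ht2].
  intros N; cbv beta; unfold rotated_box; rewrite lsum_app, !lsum_map.
  rewrite <- !lsum_list_prod; f_equal; apply lsum_ext; intros p; symmetry.
  + apply gterm_even_pair.
  + apply gterm_odd_pair.
Qed.

(** * Quasi-periodicity, parity and Landen's transformation *)

Lemma Th_shift (a b : R) (tau : C) : (0 < Im tau)%R ->
  Th a (b + 1) tau = cis a * Th a b tau.
Proof.
intros Ht; apply (Ccv_unique (fun N => lsum (gterm a (b + 1) tau) (zrange N))).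
- now apply Ccv_Th.
- eapply Ccv_ext; [|exact (Ccv_mult _ _ _ _ (Ccv_const (cis a)) (Ccv_Th a b tau Ht))].
  intros N; cbv beta; rewrite <- lsum_scal; apply lsum_ext; intros n.
  (* Raising [b] by 1 multiplies the term [n] by [cis (n + a)], which is [cis a] for every integer
     [n]. *)
  transitivity (cis (IZR n) * cis a * gterm a b tau n); [rewrite cis_IZR; ring|].
  unfold cis, gterm; rewrite <- !Cexp_add; f_equal; f_equal; ring.
Qed.

(* Exchange the [k]-th and [(-k-1)]-th terms. *)
Lemma Th_half_opp (b : R) (tau : C) : Th (1 / 2) (- b) tau = Th (1 / 2) b tau.
Proof.
apply CSeries_ext; intros k; rewrite Cplus_comm; f_equal; unfold gterm;
  rewrite minus_IZR, opp_IZR; f_equal; f_equal; field.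
Qed.

(** The shift from -1/2 to 1/2 multiplies by [cis (1 / 2) = -1], while evenness in [b] leaves the
    value unchanged; so it equals its own opposite. *)
Lemma Th_odd_0 (tau : C) : (0 < Im tau)%R -> Th (1 / 2) (- (1 / 2)) tau = 0.
Proof.
intros Ht; assert (E := Th_shift (1 / 2) (- (1 / 2)) tau Ht).
replace (- (1 / 2) + 1)%R with (1 / 2)%R in E by field.
rewrite <- (Th_half_opp (1 / 2)), cis_half in E.
set (t := Th _ _ _) in *.
replace t with ((t - - (1) * t) / 2) by (field; apply RtoC_neq; lra).
rewrite <- E; unfold Cdiv; ring.
Qed.

(** In the product formula with equal [a] and a half-step in [b], the second product contains the
    vanishing constant of [Th_odd_0]. *)
Lemma Th_landen (a b : R) (tau : C) : (0 < Im tau)%R ->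
  Th a b tau * Th a (b + 1 / 2) tau
  = Th a (2 * b + 1 / 2) (2 * tau) * Th 0 (1 / 2) (2 * tau).
Proof.
intros Ht; assert (Ht2 : (0 < Im (2 * tau))%R) by (rewrite Im_double; lra).
rewrite Th_mult by exact Ht.
replace ((a + a) / 2)%R with a by field.
replace ((a - a) / 2)%R with 0%R by field.
replace ((a - a + 1) / 2)%R with (1 / 2)%R by field.
replace (b + (b + 1 / 2))%R with (2 * b + 1 / 2)%R by field.
replace (b - (b + 1 / 2))%R with (- (1 / 2))%R by field.
rewrite Th_odd_0 by exact Ht2.
replace (Th 0 (1 / 2) (2 * tau)) with (Th 0 (- (1 / 2) + 1) (2 * tau))
  by (f_equal; field).
rewrite Th_shift, cis_0 by exact Ht2; ring.
Qed.

(** * Non-vanishing of theta constants *)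

Lemma Th_neq_0_large (a b : R) (tau : C) :
  (0 < Im tau)%R -> (3 <= PI * Im tau * (1 - 2 * Rabs a))%R -> Th a b tau <> 0.
Proof.
intros Ht Hl.
set (x := exp (- (PI * Im tau * (1 - 2 * Rabs a)))).
assert (Hx : (0 <= x <= 1 / 4)%R).
{ split; [apply Rlt_le, exp_pos|].
  (* The bound 3 is chosen for exp(-3) <= 1/(1+3) = 1/4. The terms other than the central one then
     contribute at most 2x/(1-x) <= 2/3 of its modulus [K], which leaves [K / 3]. *)
  apply Rle_trans with (exp (- (3))); [apply exp_le_exp; lra|].
  rewrite exp_Ropp; assert (H := exp_ineq1_le 3).
  apply Rle_trans with (/ (4))%R; [apply Rinv_le_contravar|]; lra. }
set (K := Cmod (gterm a b tau 0)).
assert (HK : (0 < K)%R) by (unfold K; rewrite Cmod_gterm; apply exp_pos).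
assert (H := Ccv_Th a b tau Ht).
apply (Ccv_neq_0 (fun N => lsum (gterm a b tau) (zrange (S N))) _ (K / 3)).
- lra.
- intros N.
  assert (D : ((1 - x) * Cmod (lsum (gterm a b tau) (zrange (S N)) - gterm a b tau 0)
     <= K * (2 * x - x ^ S N - x ^ S (S N)))%R).
  { apply lsum_zrange_dominant; [lra | intros n; now apply gterm_le_dominant]. }
  set (s := lsum _ _) in *.
  assert (P1 : (0 <= x ^ S N)%R) by (apply pow_le; lra).
  assert (P2 : (0 <= x ^ S (S N))%R) by (apply pow_le; lra).
  assert (T := Cmod_triangle s (gterm a b tau 0 - s)).
  replace (s + (gterm a b tau 0 - s)) with (gterm a b tau 0) in T by ring.
  fold K in T.
  replace (gterm a b tau 0 - s) with (- (s - gterm a b tau 0)) in T by ring.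
  rewrite Cmod_opp in T.
  set (m := Cmod (s - gterm a b tau 0)) in *.
  assert (Hm : (0 <= m)%R) by apply Cmod_ge_0.
  assert ((1 - x) * m <= K * (2 * x))%R by nra.
  nra.
- destruct H as [H1 H2]; split.
  + now apply (is_lim_seq_incr_1 (fun N => Re (lsum (gterm a b tau) (zrange N)))).
  + now apply (is_lim_seq_incr_1 (fun N => Im (lsum (gterm a b tau) (zrange N)))).
Qed.

(** Landen at [a = b = 0] has a square of this same constant at [2 * tau] on the right, so a zero at
    [tau] propagates; [n] counts the doublings. *)
Lemma Th_0_half_neq_0_pow (n : nat) (tau : C) :
  (0 < Im tau)%R -> (3 <= PI * (2 ^ n * Im tau))%R -> Th 0 (1 / 2) tau <> 0.
Proof.
revert tau; induction n as [|n IH]; intros tau Ht Hn.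
- apply Th_neq_0_large; [exact Ht | rewrite Rabs_R0; simpl in Hn; lra].
- assert (Ht2 : (0 < Im (2 * tau))%R) by (rewrite Im_double; lra).
  assert (Q : Th 0 (1 / 2) (2 * tau) <> 0).
  { apply IH; [exact Ht2 | rewrite Im_double; simpl in Hn; lra]. }
  intros E; assert (L := Th_landen 0 0 tau Ht).
  replace (0 + 1 / 2)%R with (1 / 2)%R in L by field.
  replace (2 * 0 + 1 / 2)%R with (1 / 2)%R in L by field.
  rewrite E, Cmult_0_r in L; exact (Cmult_neq_0 _ _ Q Q (eq_sym L)).
Qed.

Lemma ex_pow2_ge (y M : R) : (0 < y)%R -> exists n : nat, (M <= 2 ^ n * y)%R.
Proof.
intros Hy; destruct (Pow_x_infinity 2 ltac:(rewrite Rabs_pos_eq; lra) (M / y)) as [n Hn].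
exists n; specialize (Hn n (Nat.le_refl n)).
rewrite Rabs_pos_eq in Hn by (apply pow_le; lra).
apply Rge_le, (Rmult_le_compat_r y) in Hn; [|lra].
unfold Rdiv in Hn; rewrite Rmult_assoc, Rinv_l in Hn by lra; lra.
Qed.

Lemma Th_0_half_neq_0 (tau : C) : (0 < Im tau)%R -> Th 0 (1 / 2) tau <> 0.
Proof.
intros Ht; assert (HP := PI_RGT_0).
destruct (ex_pow2_ge (PI * Im tau) 3) as [n Hn]; [nra|].
apply (Th_0_half_neq_0_pow n); [exact Ht | nra].
Qed.

(** The same descent, once the other factor [Th 0 (1 / 2)] in Landen's formula is known not to
    vanish. Each doubling turns [b] into [2 * b + 1 / 2], so [b] must stay general in the
    induction. *)
Lemma Th_neq_0_pow (n : nat) (a b : R) (tau : C) : (0 < Im tau)%R ->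
  (3 <= 2 ^ n * (PI * Im tau * (1 - 2 * Rabs a)))%R -> Th a b tau <> 0.
Proof.
revert b tau; induction n as [|n IH]; intros b tau Ht Hn.
- apply Th_neq_0_large; [exact Ht | simpl in Hn; lra].
- assert (Ht2 : (0 < Im (2 * tau))%R) by (rewrite Im_double; lra).
  assert (Q : Th a (2 * b + 1 / 2) (2 * tau) <> 0).
  { apply IH; [exact Ht2 | rewrite Im_double; simpl in Hn; nra]. }
  intros E; assert (L := Th_landen a b tau Ht).
  rewrite E, Cmult_0_l in L.
  exact (Cmult_neq_0 _ _ Q (Th_0_half_neq_0 _ Ht2) (eq_sym L)).
Qed.

(* Doubling [tau] leaves [a] unchanged, and for [|a| < 1/2] the term [n = 0]
   dominates all others once [Im tau] is large. *)
Lemma Th_neq_0 (a b : R) (tau : C) :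
  (0 < Im tau)%R -> (Rabs a < 1 / 2)%R -> Th a b tau <> 0.
Proof.
intros Ht Ha; assert (HP := PI_RGT_0).
destruct (ex_pow2_ge (PI * Im tau * (1 - 2 * Rabs a)) 3) as [n Hn].
- apply Rmult_lt_0_compat; nra.
- now apply (Th_neq_0_pow n).
Qed.

(** * The odd theta function and its three-term identity *)

(* Up to an exponential factor, Jacobi's odd theta function at [al tau + be]. *)
Definition theta11 (al be : R) (tau : C) : C := Th (al + 1 / 2) (be + 1 / 2) tau.

(** A 2x2 minor: the point [(a, b)] has the row [Th a (2 * b)], [Th (a + 1 / 2) (2 * b)], both at
    [2 * tau]. *)
Definition pluecker (al be al' be' : R) (tau : C) : C :=
  Th al (2 * be) (2 * tau) * Th (al' + 1 / 2) (2 * be') (2 * tau)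
  - Th (al + 1 / 2) (2 * be) (2 * tau) * Th al' (2 * be') (2 * tau).

(** The product formula gives [2 * be + 1] in place of [2 * be]. Undoing this shift costs [cis al]
    in one product and [cis (al + 1 / 2) = - cis al] in the other, which turns the sum into a
    determinant. *)
Lemma theta11_mult (al be al' be' : R) (tau : C) : (0 < Im tau)%R ->
  theta11 (al + al') (be + be') tau * theta11 (al - al') (be - be') tau
  = cis al * pluecker al be al' be' tau.
Proof.
intros Ht; assert (Ht2 : (0 < Im (2 * tau))%R) by (rewrite Im_double; lra).
unfold theta11; rewrite Th_mult by exact Ht.
replace ((al + al' + 1 / 2 + (al - al' + 1 / 2)) / 2)%R with (al + 1 / 2)%R by field.
replace ((al + al' + 1 / 2 - (al - al' + 1 / 2)) / 2)%R with al' by field.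
replace ((al + al' + 1 / 2 + (al - al' + 1 / 2) - 1) / 2)%R with al by field.
replace ((al + al' + 1 / 2 - (al - al' + 1 / 2) + 1) / 2)%R
  with (al' + 1 / 2)%R by field.
replace (be + be' + 1 / 2 + (be - be' + 1 / 2))%R with (2 * be + 1)%R by field.
replace (be + be' + 1 / 2 - (be - be' + 1 / 2))%R with (2 * be')%R by field.
rewrite !Th_shift, cis_add, cis_half by exact Ht2; unfold pluecker; ring.
Qed.

(* The Pluecker relation for the four points [u + s], [u - s], [s] and [0]. *)
Lemma theta11_three_term (al be s : R) (tau : C) : (0 < Im tau)%R ->
  cis al * (theta11 (2 * al) (2 * be) tau * theta11 0 (2 * s) tau * theta11 0 s tau ^ 2)
  = theta11 al be tau * (theta11 al (be + 2 * s) tau * theta11 al (be - s) tau ^ 2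
                   - theta11 al (be - 2 * s) tau * theta11 al (be + s) tau ^ 2).
Proof.
intros Ht.
(* With a, b, c, d for the points [u + s], [u - s], [s], 0, the relation used is [ab][cd] = [ac][bd]
   - [ad][bc]. *)
assert (Eab := theta11_mult al (be + s) al (be - s) tau Ht).
assert (Ecd := theta11_mult 0 s 0 0 tau Ht).
assert (Eac := theta11_mult al (be + s) 0 s tau Ht).
assert (Ebd := theta11_mult al (be - s) 0 0 tau Ht).
assert (Ead := theta11_mult al (be + s) 0 0 tau Ht).
assert (Ebc := theta11_mult al (be - s) 0 s tau Ht).
rewrite ?Rplus_0_r, ?Rminus_0_r in *; rewrite cis_0 in Ecd.
replace (al + al)%R with (2 * al)%R in Eab by ring.
replace (al - al)%R with 0%R in Eab by ring.
replace (be + s + (be - s))%R with (2 * be)%R in Eab by ring.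
replace (be + s - (be - s))%R with (2 * s)%R in Eab by ring.
replace (be + s + s)%R with (be + 2 * s)%R in Eac by ring.
replace (be + s - s)%R with be in Eac by ring.
replace (be - s + s)%R with be in Ebc by ring.
replace (be - s - s)%R with (be - 2 * s)%R in Ebc by ring.
transitivity (cis al * ((theta11 (2 * al) (2 * be) tau * theta11 0 (2 * s) tau)
  * (theta11 0 s tau * theta11 0 s tau))); [ring|].
transitivity ((theta11 al (be + 2 * s) tau * theta11 al be tau)
    * (theta11 al (be - s) tau * theta11 al (be - s) tau)
  - (theta11 al be tau * theta11 al (be - 2 * s) tau)
    * (theta11 al (be + s) tau * theta11 al (be + s) tau)); [|ring].
(* All four minors on the right carry [cis al], on the left only [ab] does, as [cis 0 = 1]; the
   prefactor [cis al] restores the balance. *)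
rewrite Eab, Ecd, Eac, Ebd, Ead, Ebc; unfold pluecker; rewrite !Rplus_0_l; ring.
Qed.

(** * The ratio A : B as a quotient of cubic forms *)

Lemma Cdiv_0_r (z : C) : z / 0 = 0.
Proof.
unfold Cdiv, Cinv, Cmult, RtoC, Rdiv; cbn [fst snd].
rewrite Ropp_0, Rmult_0_l; f_equal; ring.
Qed.

Lemma Cmult_eq_0_reg_l (x y : C) : x <> 0 -> x * y = 0 -> y = 0.
Proof.
intros Hx E; destruct (Ceq_dec y 0) as [Hy|Hy]; [exact Hy|].
now destruct (Cmult_neq_0 _ _ Hx Hy).
Qed.

(* When [B = 0] the denominator [G'] vanishes too, and both quotients are [0]. *)
Lemma Cdiv_eq_of_common_factor (A B X f k G H G' H' : C) :
  X <> 0 -> f <> 0 -> k <> 0 ->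
  X * (A * B ^ 2) = f * G -> X * (B * A ^ 2) = f * H ->
  G' = k * G -> H' = k * H -> A / B = H' / G'.
Proof.
intros HX Hf Hk EG EH -> ->.
destruct (Ceq_dec B 0) as [->|HB].
{ rewrite (Cmult_eq_0_reg_l f G Hf), Cmult_0_r, !Cdiv_0_r; [reflexivity|].
  rewrite <- EG; ring. }
destruct (Ceq_dec A 0) as [->|HA].
{ rewrite (Cmult_eq_0_reg_l f H Hf); [unfold Cdiv; ring|].
  rewrite <- EH; ring. }
replace G with (X * (A * B ^ 2) / f) by (rewrite EG; field; exact Hf).
replace H with (X * (B * A ^ 2) / f) by (rewrite EH; field; exact Hf).
field; auto.
Qed.

(* The three-term identity at [u = - tau / 5 + v - 1 / 2] with [s = -1 / 5] and
   with [s = -2 / 5]; the left-hand sides have the ratio [A : B]. *)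
Lemma Th_fifth_ratio (tau : C) (v : R) (k G H : C) : (0 < Im tau)%R ->
  let d := fun x => Th (3 / 10) x tau in
  k <> 0 ->
  G = k * (d (v - 2 / 5)%R * d (v + 1 / 5)%R ^ 2 - d (v + 2 / 5)%R * d (v - 1 / 5)%R ^ 2) ->
  H = k * (d (v - 4 / 5)%R * d (v + 2 / 5)%R ^ 2 - d (v + 4 / 5)%R * d (v - 2 / 5)%R ^ 2) ->
  Th (1 / 2) (1 / 10) tau / Th (1 / 2) (3 / 10) tau = H / G.
Proof.
intros Ht d Hk EG EH.
(* The common factors are the values at [2 u], with its prefactor, and at [u]; their first
   characteristics 1/10 and 3/10 lie below 1/2, so neither vanishes. *)
refine (Cdiv_eq_of_common_factor _ _
  (cis (- (1 / 5)) * Th (1 / 10) (2 * v - 1 / 2) tau) (d v) k _ _ _ _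
  _ _ Hk _ _ EG EH).
- apply Cmult_neq_0; [apply cis_neq_0 | apply Th_neq_0; [exact Ht|]].
  rewrite Rabs_pos_eq; lra.
- unfold d; apply Th_neq_0; [exact Ht | rewrite Rabs_pos_eq; lra].
(* The points [2 * s] and [s] give -2/5 + 1/2 = 1/10 and -1/5 + 1/2 = 3/10, hence A B^2. *)
- assert (E := theta11_three_term (- (1 / 5)) (v - 1 / 2) (- (1 / 5)) tau Ht).
  unfold theta11 in E.
  replace (2 * - (1 / 5) + 1 / 2)%R with (1 / 10)%R in E by field.
  replace (2 * (v - 1 / 2) + 1 / 2)%R with (2 * v - 1 / 2)%R in E by field.
  replace (0 + 1 / 2)%R with (1 / 2)%R in E by field.
  replace (- (1 / 5) + 1 / 2)%R with (3 / 10)%R in E by field.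
  replace (v - 1 / 2 + 1 / 2)%R with v in E by field.
  replace (v - 1 / 2 + 2 * - (1 / 5) + 1 / 2)%R with (v - 2 / 5)%R in E by field.
  replace (v - 1 / 2 - 2 * - (1 / 5) + 1 / 2)%R with (v + 2 / 5)%R in E by field.
  replace (v - 1 / 2 + - (1 / 5) + 1 / 2)%R with (v - 1 / 5)%R in E by field.
  replace (v - 1 / 2 - - (1 / 5) + 1 / 2)%R with (v + 1 / 5)%R in E by field.
  unfold d; rewrite <- E; ring.
(* Now [2 * s] gives -4/5 + 1/2 = -3/10, which is B by evenness, and [s] gives 1/10, hence B A^2. *)
- assert (E := theta11_three_term (- (1 / 5)) (v - 1 / 2) (- (2 / 5)) tau Ht).
  unfold theta11 in E.
  replace (2 * - (1 / 5) + 1 / 2)%R with (1 / 10)%R in E by field.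
  replace (2 * (v - 1 / 2) + 1 / 2)%R with (2 * v - 1 / 2)%R in E by field.
  replace (0 + 1 / 2)%R with (1 / 2)%R in E by field.
  replace (- (1 / 5) + 1 / 2)%R with (3 / 10)%R in E by field.
  replace (2 * - (2 / 5) + 1 / 2)%R with (- (3 / 10))%R in E by field.
  replace (- (2 / 5) + 1 / 2)%R with (1 / 10)%R in E by field.
  replace (v - 1 / 2 + 1 / 2)%R with v in E by field.
  replace (v - 1 / 2 + 2 * - (2 / 5) + 1 / 2)%R with (v - 4 / 5)%R in E by field.
  replace (v - 1 / 2 - 2 * - (2 / 5) + 1 / 2)%R with (v + 4 / 5)%R in E by field.
  replace (v - 1 / 2 + - (2 / 5) + 1 / 2)%R with (v - 2 / 5)%R in E by field.
  replace (v - 1 / 2 - - (2 / 5) + 1 / 2)%R with (v + 2 / 5)%R in E by field.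
  rewrite Th_half_opp in E; unfold d; rewrite <- E; ring.
Qed.

(** * Tenth roots of unity and the five formulas *)

Lemma cis_tenth_pow5 : cis (1 / 10) ^ 5 = - (1).
Proof.
simpl; rewrite Cmult_1_r, <- !cis_add, <- cis_half; f_equal; field.
Qed.

Lemma zeta5_cis : zeta5 = cis (1 / 10) ^ 2.
Proof.
simpl; rewrite Cmult_1_r, <- cis_add; unfold zeta5, cis.
replace (2 * PI * Ci / 5) with (0, 2 * PI * (1 / 10 + 1 / 10))%R; [reflexivity|].
unfold Cdiv; rewrite <- RtoC_inv by lra.
unfold Cmult, Ci, RtoC; cbn [fst snd]; f_equal; field.
Qed.

Theorem theorem4p6 (tau : C) (Htau : (0 < Im tau)%R) :
  let A := thetac 1 (1/5) tau in
  let B := thetac 1 (3/5) tau in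
  let d := fun k : R => thetac (3/5) (k/5) tau in
  let z := zeta5 in
  A / B = (d 1 ^ 2 * d 3 - z ^ 2 * d 9 ^ 2 * d 7)
          / (z * d 7 ^ 2 * d 1 - z * d 3 ^ 2 * d 9) /\
  A / B = (z * d 5 ^ 2 * d 7 + d 3 ^ 2 * d 1)
          / (d 1 ^ 2 * d 5 + z * d 7 ^ 2 * d 3) /\
  A / B = (z * d 7 ^ 2 * d 5 - z * d 9 ^ 2 * d 1)
          / (d 1 ^ 2 * d 7 + z * d 5 ^ 2 * d 9) /\
  A / B = (- (d 1 ^ 2 * d 9) + d 3 ^ 2 * d 5)
          / (z * d 9 ^ 2 * d 3 + d 5 ^ 2 * d 1) /\
  A / B = (z * d 7 ^ 2 * d 9 + d 5 ^ 2 * d 3)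
          / (d 3 ^ 2 * d 7 + z * d 9 ^ 2 * d 5).
Proof.
intros A B d z.
set (w := cis (1 / 10)); assert (Hw := cis_tenth_pow5 : w ^ 5 = - (1)).
assert (Hw0 : w <> 0) by apply cis_neq_0.
assert (Hz : z = w ^ 2) by apply zeta5_cis.
(* Three ways to read a value as some [d k]: directly, after a step up by 1 with factor
   [cis (3 / 10) = w ^ 3], or after a step down with factor [w ^ (-3) = - w ^ 2], since
   [w ^ 5 = -1]. *)
assert (Ed : forall k x : R, x = (k / 10)%R -> Th (3 / 10) x tau = d k).
{ intros k x ->; unfold d; rewrite thetac_Th; f_equal; field. }
assert (Eu : forall k x : R, x = (k / 10 + 1)%R -> Th (3 / 10) x tau = w ^ 3 * d k).
{ intros k x ->; rewrite Th_shift, (Ed k _ eq_refl) by exact Htau; f_equal.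
  simpl; rewrite Cmult_1_r; unfold w; rewrite <- !cis_add; f_equal; field. }
assert (El : forall k x : R, x = (k / 10 - 1)%R -> Th (3 / 10) x tau = - w ^ 2 * d k).
{ intros k x ->; rewrite <- (Ed k (k / 10 - 1 + 1)%R) by field.
  rewrite (Eu (k - 10)%R (k / 10 - 1 + 1)%R) by field.
  rewrite <- (Ed (k - 10)%R (k / 10 - 1)%R) by field; ring [Hw]. }
assert (EA : A = Th (1 / 2) (1 / 10) tau) by (unfold A; rewrite thetac_Th; f_equal; field).
assert (EB : B = Th (1 / 2) (3 / 10) tau) by (unfold B; rewrite thetac_Th; f_equal; field).
rewrite EA, EB, Hz; clear EA EB Hz.
repeat split.
(* In each formula [10 * v] is the index of the one [d] that does not occur there, being the factor
   cancelled. The power of [w] scales both forms to the stated coefficients. *)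
- apply (Th_fifth_ratio tau (5 / 10) (w ^ 2)); [exact Htau | now apply Cpow_nz | |].
  + rewrite (Ed 1 (5 / 10 - 2 / 5)%R), (Ed 7 (5 / 10 + 1 / 5)%R),
      (Ed 9 (5 / 10 + 2 / 5)%R), (Ed 3 (5 / 10 - 1 / 5)%R) by field; ring [Hw].
  + rewrite (El 7 (5 / 10 - 4 / 5)%R), (Ed 9 (5 / 10 + 2 / 5)%R),
      (Eu 3 (5 / 10 + 4 / 5)%R), (Ed 1 (5 / 10 - 2 / 5)%R) by field; ring [Hw].
- apply (Th_fifth_ratio tau (9 / 10) (w ^ 4)); [exact Htau | now apply Cpow_nz | |].
  + rewrite (Ed 5 (9 / 10 - 2 / 5)%R), (Eu 1 (9 / 10 + 1 / 5)%R),
      (Eu 3 (9 / 10 + 2 / 5)%R), (Ed 7 (9 / 10 - 1 / 5)%R) by field; ring [Hw].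
  + rewrite (Ed 1 (9 / 10 - 4 / 5)%R), (Eu 3 (9 / 10 + 2 / 5)%R),
      (Eu 7 (9 / 10 + 4 / 5)%R), (Ed 5 (9 / 10 - 2 / 5)%R) by field; ring [Hw].
- apply (Th_fifth_ratio tau (3 / 10) (w ^ 5)); [exact Htau | now apply Cpow_nz | |].
  + rewrite (El 9 (3 / 10 - 2 / 5)%R), (Ed 5 (3 / 10 + 1 / 5)%R),
      (Ed 7 (3 / 10 + 2 / 5)%R), (Ed 1 (3 / 10 - 1 / 5)%R) by field; ring [Hw].
  + rewrite (El 5 (3 / 10 - 4 / 5)%R), (Ed 7 (3 / 10 + 2 / 5)%R),
      (Eu 1 (3 / 10 + 4 / 5)%R), (El 9 (3 / 10 - 2 / 5)%R) by field; ring [Hw].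
- apply (Th_fifth_ratio tau (7 / 10) (w ^ 2)); [exact Htau | now apply Cpow_nz | |].
  + rewrite (Ed 3 (7 / 10 - 2 / 5)%R), (Ed 9 (7 / 10 + 1 / 5)%R),
      (Eu 1 (7 / 10 + 2 / 5)%R), (Ed 5 (7 / 10 - 1 / 5)%R) by field; ring [Hw].
  + rewrite (El 9 (7 / 10 - 4 / 5)%R), (Eu 1 (7 / 10 + 2 / 5)%R),
      (Eu 5 (7 / 10 + 4 / 5)%R), (Ed 3 (7 / 10 - 2 / 5)%R) by field; ring [Hw].
- apply (Th_fifth_ratio tau (1 / 10) (w ^ 3)); [exact Htau | now apply Cpow_nz | |].
  + rewrite (El 7 (1 / 10 - 2 / 5)%R), (Ed 3 (1 / 10 + 1 / 5)%R),
      (Ed 5 (1 / 10 + 2 / 5)%R), (El 9 (1 / 10 - 1 / 5)%R) by field; ring [Hw].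
  + rewrite (El 3 (1 / 10 - 4 / 5)%R), (Ed 5 (1 / 10 + 2 / 5)%R),
      (Ed 9 (1 / 10 + 4 / 5)%R), (El 7 (1 / 10 - 2 / 5)%R) by field; ring [Hw].
Qed.
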